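(* Assume the network is UJSC, the weight rules hold, and the interior-point condition for $(\mathrm{ADRCP}^k)$ holds. Let the stepsizes $\alpha(t)>0$ be nonincreasing with $\alpha(t)=\Theta(1/\sqrt{t})$, i.e. there are constants $0<\kappa_1\le\kappa_2$ with $\kappa_1/\sqrt{t+1}\le\alpha(t)\le\kappa_2/\sqrt{t+1}$ for all $t\ge0$. For the DPG iteration $\theta_i(t+1)=P_{\Omega_i}\big[\sum_{j=1}^m a_{ij}(t)\theta_j(t)-\alpha(t)c\big]$ define $\hat\theta_i(t)=\sum_{r=0}^t\alpha(r)\theta_i(r)\big/\sum_{\tau=0}^t\alpha(\tau)$. Then there is a constant $K$ such that for all $i\in\mathcal V$ and all $t\ge 1$, $|f_0(\hat\theta_i(t))-f_0^*|\le K\,\ln(t+1)/\sqrt{t}$; i.e. $|f_0(\hat\theta_i(t))-f_0^*|=O(\ln t/\sqrt t)$.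
   Context: Network: agents $\mathcal V=\{1,\dots,m\}$. For each time slot $t\in\mathbb Z_{\ge 0}$ there is a directed graph $\mathcal G(t)=(\mathcal V,\mathcal E(t))$; $(j,i)\in\mathcal E(t)$ means agent $j$ can send information to agent $i$ at slot $t$, and $N_i^{in}(t)=\{j:(j,i)\in\mathcal E(t)\}$. UJSC (uniform joint strong connectivity): there is an integer $S>0$ such that for every $t\ge 0$ the graph $(\mathcal V,\mathcal E(t)\cup\cdots\cup\mathcal E(t+S-1))$ is strongly connected. Weight rules: $A(t)=[a_{ij}(t)]\in\mathbb R^{m\times m}$ with $a_{ij}(t)>0$ if $j\in N_i^{in}(t)$ and $a_{ij}(t)=0$ otherwise; $\sum_{j}a_{ij}(t)=1$ for all $i,t$ (row stochastic, not necessarily column stochastic); $(i,i)\in\mathcal E(t)$ for all $i,t$; and there is $\gamma\in(0,1)$ with $a_{ij}(t)\ge\gamma$ whenever $a_{ij}(t)>0$ (in particular $a_{ii}(t)\ge\gamma$). Problem data: $X\subseteq\mathbb R^n$ is nonempty, compact and convex. For each $i\in\mathcal V$: $f_i:\mathbb R^n\to\mathbb R$ is convex; $Y_i\subseteq\mathbb R$ is nonempty, compact, convex; $g_i:\mathbb R^n\times Y_i\to\mathbb R$ is continuous on $X\times Y_i$ and convex in $x$ for each fixed $y$; $Y_i^k\subset Y_i$ is a finite set and $\epsilon_i^k>0$. The problem $(\mathrm{ADRCP}^k)$ is: minimize $\sum_{i=1}^m f_i(x)$ over $x\in X$ subject to $g_i(x,y)\le-\epsilon_i^k$ for all $y\in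 Y_i^k$ and all $i$. Interior-point condition: the feasible set of $(\mathrm{ADRCP}^k)$ is nonempty and there is $\tilde x$ in it with $g_i(\tilde x,y)<-\epsilon_i^k$ for all $y\in Y_i^k$, $i\in\mathcal V$. Epigraphic reformulation: $\theta=(x,u)\in\Theta=X\times\mathbb R^m$; $\Omega_i=\{(x,u)\in\Theta: f_i(x)-u_i\le 0,\ g_i(x,y)\le-\epsilon_i^k\ \forall y\in Y_i^k\}$; $\Omega=\bigcap_{i=1}^m\Omega_i$; $c=(0_n,\tfrac1m\mathbf 1_m)\in\mathbb R^{n+m}$ and $f_0(\theta)=c^\top\theta=\tfrac1m\sum_i u_i$. $\Omega^*$ is the set of minimizers of $f_0$ over $\Omega$ and $f_0^*$ the optimal value. $P_K$ denotes Euclidean projection onto a closed convex set $K$. Initial points $\theta_i(0)\in\mathbb R^{n+m}$ are arbitrary. *)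

(* Defs.v *)
From HB Require Import structures.
From mathcomp Require Import all_boot all_order all_algebra.
From mathcomp Require Import all_classical all_reals all_analysis.
Set Implicit Arguments. Unset Strict Implicit. Unset Printing Implicit Defensive.
Import Order.TTheory GRing.Theory Num.Theory.
Import numFieldNormedType.Exports.
Local Open Scope classical_set_scope.
Local Open Scope ring_scope.

Section Defs.
Variable R : realType.

Definition dotv d (u v : 'rV[R]_d) : R := \sum_(k < d) u 0 k * v 0 k.
Definition sqnorm d (u : 'rV[R]_d) : R := dotv u u.

Definition convex_setv d (K : set 'rV[R]_d) : Prop :=
  forall x y, K x -> K y -> forall l : R, 0 <= l <= 1 ->
    K (l *: x + (1 - l) *: y).

Definition convex_setR (K : set R) : Prop :=
  forall x y, K x -> K y -> forall l : R, 0 <= l <= 1 -> K (l * x + (1 - l) * y).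

Definition convex_fun d (f : 'rV[R]_d -> R) : Prop :=
  forall x y (l : R), 0 <= l <= 1 ->
    f (l *: x + (1 - l) *: y) <= l * f x + (1 - l) * f y.

Definition is_proj d (K : set 'rV[R]_d) (z p : 'rV[R]_d) : Prop :=
  K p /\ forall q, K q -> sqnorm (z - p) <= sqnorm (z - q).

Definition strongly_connected m (e : rel 'I_m) : Prop :=
  forall i j : 'I_m, connect e i j.

(* UJSC: E t j i means (j,i) is an edge at slot t *)
Definition UJSC m (E : nat -> rel 'I_m) : Prop :=
  exists S : nat, (0 < S)%N /\ forall t : nat,
    strongly_connected (fun a b => [exists s : 'I_S, E (t + s)%N a b]).

Definition weight_rules m (E : nat -> rel 'I_m) (A : nat -> 'M[R]_m) : Prop :=
  [/\ (forall t (i j : 'I_m), E t j i -> 0 < A t i j),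
      (forall t (i j : 'I_m), ~~ E t j i -> A t i j = 0),
      (forall t (i : 'I_m), \sum_(j < m) A t i j = 1),
      (forall t (i : 'I_m), E t i i) &
      exists gamma : R, 0 < gamma < 1 /\
        forall t (i j : 'I_m), 0 < A t i j -> gamma <= A t i j].

(* epigraphic reformulation: theta = (x,u) in R^(n+m) *)
Definition xpart n m (th : 'rV[R]_(n + m)) : 'rV[R]_n := lsubmx th.
Definition upart n m (th : 'rV[R]_(n + m)) : 'rV[R]_m := rsubmx th.

Definition Omega_i n m (X : set 'rV[R]_n) (f : 'I_m -> 'rV[R]_n -> R)
  (g : 'I_m -> 'rV[R]_n -> R -> R) (Yk : 'I_m -> seq R) (eps : 'I_m -> R)
  (i : 'I_m) : set 'rV[R]_(n + m) :=
  [set th | X (xpart th) /\ f i (xpart th) - upart th 0 i <= 0 /\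
            forall y, y \in Yk i -> g i (xpart th) y <= - eps i].

Definition Omega n m X f g Yk eps : set 'rV[R]_(n + m) :=
  [set th | forall i : 'I_m, @Omega_i n m X f g Yk eps i th].

Definition cvec n m : 'rV[R]_(n + m) := row_mx 0 (const_mx (m%:R^-1)).

Definition f0 n m (th : 'rV[R]_(n + m)) : R := dotv (cvec n m) th.

Definition f0star n m X f g Yk eps : R := inf [set f0 th | th in @Omega n m X f g Yk eps].

Definition theta_hat d (alpha : nat -> R) (th : nat -> 'rV[R]_d) (t : nat) : 'rV[R]_d :=
  (\sum_(tau < t.+1) alpha tau)^-1 *: \sum_(r < t.+1) alpha r *: th r.

End Defs.

(* Main.v *)
Require Import Defs.
From HB Require Import structures.
From mathcomp Require Import all_boot all_order all_algebra.
From mathcomp Require Import all_classical all_reals all_analysis.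
From mathcomp Require Import ring lra zify.
Import Order.TTheory GRing.Theory Num.Theory.
Import numFieldNormedType.Exports.
Local Open Scope classical_set_scope.
Local Open Scope ring_scope.

(** The objective [c] is common to all agents, so row stochasticity suffices.
    For [w] in [Omega], the variational inequality of the projection gives
      |z_i(t+1) - w|^2 <= sum_j a_ij |z_j(t) - w|^2
        - sum_j a_ij |z_j(t) - z_i(t+1)|^2 - 2 alpha(t) c.(z_i(t+1) - w).
    Averaging with weights [p(t)] such that [p(t)^T = p(t+1)^T A(t)] telescopes
    this into an energy inequality; by joint connectivity [p] is bounded below,
    and the dissipated terms of a window of length [m S] dominate the squared
    disagreement [d(t)^2] at its end. By the Slater point, every [z_i(t)] is within
    [O(d(t))] of a point of [Omega] in objective value, so the energy inequality
    reads [sum d^2 <= const + const * sum alpha d], hence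
    [sum d^2 = O(1 + sum alpha^2) = O(ln t)] and [sum alpha d = O(ln t)]. Both
    bounds on the weighted gap follow, and [sum alpha >= k1 sqrt t]. *)

Set Implicit Arguments.
Unset Strict Implicit.

(** * Vectors and convex functions *)

Section Vectors.
Context {R : realType}.

Lemma ler_coord_norm d (u : 'rV[R]_d) (i : 'I_d) : `|u 0 i| <= `|u|.
Proof.
have -> : `|u| = \big[Num.max/0]_ij `|u ij.1 ij.2| := mx_normrE u.
exact: (le_bigmax _ (fun ij : 'I_1 * 'I_d => `|u ij.1 ij.2|) (0, i)).
Qed.

Lemma rV_norm_le d (u : 'rV[R]_d) (b : R) :
  0 <= b -> (forall i, `|u 0 i| <= b) -> `|u| <= b.
Proof.
move=> b0 ub; have -> : `|u| = \big[Num.max/0]_ij `|u ij.1 ij.2| := mx_normrE u.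
by apply/bigmax_leP; split=> // -[i j] _ /=; rewrite (ord1 i).
Qed.

Lemma sqnorm_ge0 d (u : 'rV[R]_d) : 0 <= sqnorm u.
Proof. by apply: sumr_ge0 => i _; rewrite -expr2 sqr_ge0. Qed.

Lemma norm_sqr_le_sqnorm d (u : 'rV[R]_d) : `|u| ^+ 2 <= sqnorm u.
Proof.
rewrite -[leRHS]sqr_sqrtr ?sqnorm_ge0// ler_sqr ?nnegrE ?sqrtr_ge0//.
apply: rV_norm_le => [|i]; first exact: sqrtr_ge0.
rewrite -sqrtr_sqr ler_sqrt ?sqnorm_ge0// /sqnorm /dotv (bigD1 i)//= expr2.
by rewrite lerDl sumr_ge0// => j _; rewrite -expr2 sqr_ge0.
Qed.

Lemma sqnorm_le_norm d (u : 'rV[R]_d) : sqnorm u <= d%:R * `|u| ^+ 2.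
Proof.
have -> : d%:R * `|u| ^+ 2 = \sum_(k < d) `|u| ^+ 2.
  by rewrite sumr_const card_ord mulr_natl.
apply: ler_sum => i _; rewrite -expr2 -real_normK ?num_real//.
by rewrite ler_sqr ?nnegrE// ler_coord_norm.
Qed.

Lemma dotvDl d (u v w : 'rV[R]_d) : dotv (u + v) w = dotv u w + dotv v w.
Proof. by rewrite /dotv -big_split; apply: eq_bigr => i _; rewrite mxE mulrDl. Qed.

Lemma dotvZl d (a : R) (u w : 'rV[R]_d) : dotv (a *: u) w = a * dotv u w.
Proof. by rewrite /dotv mulr_sumr; apply: eq_bigr => i _; rewrite mxE mulrA. Qed.

Lemma dotvC d (u v : 'rV[R]_d) : dotv u v = dotv v u.
Proof. by apply: eq_bigr => i _; rewrite mulrC. Qed.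

Lemma dotvNl d (u w : 'rV[R]_d) : dotv (- u) w = - dotv u w.
Proof. by rewrite -scaleN1r dotvZl mulN1r. Qed.

Lemma dotv_suml d (I : finType) (F : I -> 'rV[R]_d) (w : 'rV[R]_d) :
  dotv (\sum_i F i) w = \sum_i dotv (F i) w.
Proof.
rewrite (big_morph (fun u => dotv u w) (id1 := 0) (op1 := +%R))//.
  by move=> u v; rewrite dotvDl.
by rewrite /dotv big1// => k _; rewrite mxE mul0r.
Qed.

Lemma sqnormD d (u v : 'rV[R]_d) :
  sqnorm (u + v) = sqnorm u + 2 * dotv u v + sqnorm v.
Proof. rewrite /sqnorm dotvDl !(dotvC _ (u + v)) !dotvDl (dotvC v u); ring. Qed.

Lemma sqnormZ d (a : R) (u : 'rV[R]_d) : sqnorm (a *: u) = a ^+ 2 * sqnorm u.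
Proof. by rewrite /sqnorm dotvZl dotvC dotvZl mulrA. Qed.

(** If the inner product [D] were positive, a short move from [p] towards [q] would stay in [K] and
    come strictly closer to [z]: the squared distance changes by [l * (l * Q - 2 * D)]. *)
Lemma proj_variational d (K : set 'rV[R]_d) (z p q : 'rV[R]_d) :
  convex_setv K -> is_proj K z p -> K q -> dotv (z - p) (q - p) <= 0.
Proof.
move=> cK [Kp pmin] Kq; rewrite leNgt; apply/negP => D0.
set D := dotv _ _ in D0; set Q := sqnorm (q - p).
have Q0 : 0 <= Q := sqnorm_ge0 _.
have DQ : 0 < D + Q by lra.
(* The denominator [D + Q] keeps [l] at most 1, makes sense when [Q = 0], and gives
   [l * Q < 2 * D]. *)
pose l := D / (D + Q).
have l0 : 0 < l by rewrite divr_gt0.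
have l1 : 0 <= l <= 1 by rewrite ltW//= ler_pdivrMr// mul1r lerDl.
have := pmin _ (cK _ _ Kq Kp _ l1).
have -> : z - (l *: q + (1 - l) *: p) = (z - p) + (- l) *: (q - p).
  by apply/rowP => k; rewrite !mxE; ring.
rewrite (sqnormD (z - p)) dotvC dotvZl dotvC sqnormZ -/D -/Q.
have lE : l * (D + Q) = D by rewrite divfK// lt0r_neq0.
have : l * Q < 2 * D by nra.
by nra.
Qed.

(** Expanding each [sqnorm (z j - w)] around [p] and averaging leaves a cross term, which the
    variational inequality at [w] bounds below by [al * dotv c (p - w)]. *)
Lemma proj_step d m (a : 'I_m -> R) (z : 'I_m -> 'rV[R]_d) (al : R)
    (c p w : 'rV[R]_d) (K : set 'rV[R]_d) :
  \sum_j a j = 1 -> convex_setv K ->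
  is_proj K (\sum_j a j *: z j - al *: c) p -> K w ->
  sqnorm (p - w) <= \sum_j a j * sqnorm (z j - w)
    - \sum_j a j * sqnorm (z j - p) - 2 * al * dotv c (p - w).
Proof.
move=> a1 cK pp Kw.
have := proj_variational cK pp Kw.
rewrite -(opprB p w) dotvC dotvNl dotvC.
have -> : \sum_j a j *: z j - al *: c - p
    = \sum_j a j *: (z j - p) - al *: c.
  under [in RHS]eq_bigr => j _ do rewrite scalerBr.
  by rewrite sumrB -scaler_suml a1 scale1r addrAC.
rewrite dotvDl dotvNl dotvZl dotv_suml oppr_le0 => var.
have -> : \sum_j a j * sqnorm (z j - w) = \sum_j a j * sqnorm (z j - p)
    + 2 * (\sum_j dotv (a j *: (z j - p)) (p - w)) + sqnorm (p - w).
  have -> : sqnorm (p - w) = \sum_j a j * sqnorm (p - w).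
    by rewrite -mulr_suml a1 mul1r.
  rewrite mulr_sumr -!big_split /=.
  apply: eq_bigr => j _.
  have -> : z j - w = (z j - p) + (p - w) by rewrite addrA subrK.
  rewrite (sqnormD (z j - p)) dotvZl; ring.
by lra.
Qed.

Lemma convex_comb_le (l a b M : R) :
  0 <= l <= 1 -> a <= M -> b <= M -> l * a + (1 - l) * b <= M.
Proof. by move=> /andP[l0 l1] aM bM; nra. Qed.

(** The norm is the sup norm, so the ball is a cube, and convexity bounds [f] by its values at the
    vertices; one coordinate at a time is pushed to the faces. *)
Lemma convex_fun_bounded_above d (f : 'rV[R]_d -> R) (N : R) :
  convex_fun f -> exists M, forall x : 'rV[R]_d, `|x| <= N -> f x <= M.
Proof.
move=> cf; have [N0|N0] := leP N 0.
  by exists (f 0) => x xN; rewrite (_ : x = 0)//; apply/eqP;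
    rewrite -normr_le0 (le_trans xN).
(* Induction on the number [k] of free coordinates, those from [k] on being frozen to [y]. *)
suff /(_ d 0)[M HM] : forall k (y : 'rV[R]_d), exists M, forall x : 'rV[R]_d, `|x| <= N ->
    (forall i : 'I_d, (k <= i)%N -> x 0 i = y 0 i) -> f x <= M.
  by exists M => x /HM; apply => i; rewrite leqNgt ltn_ord.
elim=> [|k IH] y.
  exists (f y) => x _ xy; rewrite (_ : x = y)//.
  by apply/rowP => i; exact: xy.
have [kd|dk] := ltnP k d; last first.
  have [M HM] := IH y; exists M => x xN _; apply: HM => // i ki.
  by have := ltn_ord i; rewrite ltnNge (leq_trans dk ki).
pose upd (v : 'rV[R]_d) (s : R) : 'rV[R]_d :=
  \row_i if i == k :> nat then s else v 0 i.
have [M1 HM1] := IH (upd y N); have [M2 HM2] := IH (upd y (- N)).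
exists (Num.max M1 M2) => x xN xy.
pose s := x 0 (Ordinal kd).
have sN : - N <= s <= N by rewrite -ler_norml (le_trans (ler_coord_norm _ _)).
pose l := (s + N) / (2 * N).
have lN : l * (2 * N) = s + N by rewrite divfK//; lra.
have l01 : 0 <= l <= 1.
  by rewrite divr_ge0 ?ler_pdivrMr/=; lra.
have updN t : `|t| <= N -> `|upd x t| <= N.
  move=> tN; apply: rV_norm_le => [|i]; first exact: ltW.
  by rewrite mxE; case: ifP => // _; rewrite (le_trans (ler_coord_norm _ _)).
have updy t (i : 'I_d) : (k <= i)%N -> upd x t 0 i = upd y t 0 i.
  by rewrite !mxE leq_eqVlt eq_sym => /orP[-> //|ki]; rewrite xy.
have fN : f (upd x N) <= M1.
  by apply: HM1 => //; [apply: updN; rewrite gtr0_norm|exact: updy].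
have fNN : f (upd x (- N)) <= M2.
  by apply: HM2 => //; [apply: updN; rewrite normrN gtr0_norm|exact: updy].
have -> : x = l *: upd x N + (1 - l) *: upd x (- N).
  apply/rowP => i; rewrite !mxE; case: eqP => ik; last by ring.
  by rewrite (_ : x 0 i = s); [lra|congr (x 0 _); exact/val_inj].
apply: le_trans (cf _ _ _ l01) _.
apply: convex_comb_le => //.
  by rewrite le_max fN.
by rewrite le_max fNN orbT.
Qed.

(** Extend the segment from [y] to [x] by length 1 beyond [x], to a point [w] still in the ball of
    radius [N + 1], where [f <= M]. Convexity between [y] and [w] bounds the slope, and reflection
    through 0 bounds [f y] below. *)
Lemma convex_fun_lipschitz d (f : 'rV[R]_d -> R) (N : R) :
  convex_fun f -> exists L, 0 <= L /\
    forall x y : 'rV[R]_d, `|x| <= N -> `|y| <= N -> f x - f y <= L * `|x - y|.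
Proof.
move=> cf; have [M HM] := convex_fun_bounded_above (N + 1) cf.
pose L := 2 * (M - f 0).
(* The absolute value settles nonnegativity also when [N] is negative and the ball is empty. *)
exists `|L|; split=> // x y xN yN.
have [->|xy] := eqVneq x y; first by rewrite !subrr normr0 mulr0.
have f0M : f 0 <= M.
  by apply: HM; rewrite normr0 (le_trans (normr_ge0 x))// (le_trans xN)// lerDl.
have fyl : 2 * f 0 - M <= f y.
  have h : 0 <= (1/2 : R) <= 1 by lra.
  have := cf y (- y) _ h.
  rewrite (_ : _ + _ = 0); last by apply/rowP => i; rewrite !mxE; field.
  have : f (- y) <= M by apply: HM; rewrite normrN; lra.
  by lra.
have r0 : 0 < `|x - y| by rewrite normr_gt0 subr_eq0.
set r := `|x - y| in r0 *.
pose w := x + r^-1 *: (x - y).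
have fw : f w <= M.
  apply: HM; rewrite (le_trans (ler_normD _ _))// lerD// normrZ -/r.
  by rewrite gtr0_norm ?invr_gt0// mulVf ?gt_eqF.
pose l := r / (1 + r).
have r1 : 0 < 1 + r by lra.
have lE : l * (1 + r) = r by rewrite divfK// gt_eqF.
have l01 : 0 <= l <= 1 by rewrite divr_ge0 ?ler_pdivrMr; lra.
have xE : x = l *: w + (1 - l) *: y.
  by apply/rowP => i; rewrite !mxE /l; field; rewrite ?gt_eqF.
have := cf w y _ l01; rewrite -xE => fx.
have lr : l <= r by nra.
have LL : L <= `|L| by rewrite ler_norm.
have L0 : 0 <= L by rewrite /L; lra.
have : l * (f w - f y) <= r * L by rewrite /L; nra.
by nra.
Qed.

End Vectors.

(** * Temporal paths and backward weights *)

Section Network.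
Context {R : realType} {m : nat}.

(** A temporal path takes exactly one edge per slot; waiting at an agent is a self-loop. *)
Fixpoint reach (E : nat -> rel 'I_m) (t : nat) (j : 'I_m) (k : nat) : pred 'I_m :=
  if k is k'.+1 then
    fun i => [exists l, reach E t j k' l && E (t + k')%N l i]
  else pred1 j.

Lemma reach_le (E : nat -> rel 'I_m) t j k k' i :
  (forall t i, E t i i) -> (k <= k')%N -> reach E t j k i -> reach E t j k' i.
Proof.
move=> Eii /subnKC <-; elim: (k' - k)%N => [|n IH]; first by rewrite addn0.
by move=> /IH r; rewrite addnS /=; apply/existsP; exists i; rewrite r Eii.
Qed.

Lemma connect_invariant (e : rel 'I_m) (P : pred 'I_m) (x y : 'I_m) :
  connect e x y -> (forall a b, P a -> e a b -> P b) -> P x -> P y.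
Proof.
move=> /connectP[p + ->] closedP; elim: p x => //= a p IH x /andP[xa pa] Px.
exact: IH pa (closedP _ _ Px xa).
Qed.

Definition window (E : nat -> rel 'I_m) (S t : nat) : rel 'I_m :=
  fun a b => [exists s : 'I_S, E (t + s)%N a b].

(** If a whole window added no agent, the reached set would be closed under the edges of that
    window, and strong connectivity would make it contain everyone. *)
Lemma card_reach_lt (E : nat -> rel 'I_m) S t j k :
  (forall t i, E t i i) -> strongly_connected (window E S (t + k)) ->
  (#|reach E t j k| < m)%N ->
  (#|reach E t j k| < #|reach E t j (k + S)%N|)%N.
Proof.
move=> Eii sc ltm.
have sub : reach E t j k \subset reach E t j (k + S)%N.
  by apply/fintype.subsetP => i; apply: reach_le => //; rewrite leq_addr.
apply: proper_card; rewrite properE sub/=; apply/negP => /fintype.subsetP sup.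
suff all i : i \in reach E t j k.
  by move: ltm; rewrite (eq_card (B := predT)) ?card_ord ?ltnn// => i; exact: all.
apply: (connect_invariant (sc j i)); last first.
  by apply: (@reach_le _ _ _ 0) => //=.
(* Information waits at [a] until slot [t + k + s], then crosses to [b], still within the window. *)
move=> a b ra /existsP[s Eab]; apply: sup.
apply: (@reach_le _ _ _ (k + s).+1) => //; first by rewrite -addnS leq_add2l.
apply/existsP; exists a; rewrite addnA Eab andbT.
by apply: reach_le ra => //; rewrite leq_addr.
Qed.

Lemma reach_all (E : nat -> rel 'I_m) S t j i :
  (forall t i, E t i i) -> (forall t, strongly_connected (window E S t)) ->
  reach E t j (m * S)%N i.
Proof.
move=> Eii sc.
(* The count starts at 1 with [j] itself and gains at least one agent per window until it reaches
   [m]. *)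
have card_ge n : (minn m n.+1 <= #|reach E t j (n * S)%N|)%N.
  elim: n => [|n IH].
    apply: leq_trans (geq_minr _ _) _; apply/card_gt0P.
    by exists j; rewrite inE.
  have [full|lt] := leqP m #|reach E t j (n * S)%N|.
    rewrite (leq_trans (geq_minl _ _))// (leq_trans full)// subset_leq_card//.
    by apply/fintype.subsetP => l; apply: reach_le => //; rewrite leq_mul2r leqnSn orbT.
  have := card_reach_lt Eii (sc _) lt.
  rewrite mulSnr; lia.
have cardm : #|reach E t j (m * S)%N| = #|predT : pred 'I_m|.
  apply/eqP; rewrite eqn_leq max_card card_ord.
  by rewrite (leq_trans _ (card_ge m))// leq_min leqnn leqnSn.
by have /(_ i) := subset_cardP cardm (fintype.subset_predT _); rewrite !inE.
Qed.

Variables (E : nat -> rel 'I_m) (A : nat -> 'M[R]_m).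

(* Working up to a finite horizon [T] replaces the limits of backward products
   in the usual construction of absolute probability sequences. *)
Lemma absolute_probability (T : nat) : (0 < m)%N ->
  (forall t i j, 0 <= A t i j) -> (forall t i, \sum_j A t i j = 1) ->
  exists p : nat -> 'I_m -> R, [/\ forall t i, 0 <= p t i,
    forall t, (t <= T)%N -> \sum_i p t i = 1, forall i, p T i = m%:R^-1 &
    forall t j, (t < T)%N -> p t j = \sum_i p t.+1 i * A t i j].
Proof.
move=> m0; elim: T A => [|T IH] A' A0 A1.
  exists (fun _ _ => m%:R^-1); split => // t _.
  by rewrite sumr_const card_ord -[LHS]mulr_natr mulVf// pnatr_eq0 -lt0n.
have [//|//|p [p0 p1 pT pS]] := IH (fun t => A' t.+1).
(* One backward step through [A' 0] puts a new slot in front; row stochasticity keeps the total mass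
   1. *)
exists (fun t => if t is t'.+1 then p t' else fun j => \sum_i p 0%N i * A' 0%N i j).
split=> //.
- by case=> [|t] i //; apply: sumr_ge0 => j _; rewrite mulr_ge0.
- case=> [_|t tT]; last exact: p1.
  rewrite exchange_big/= -(p1 0%N)//; apply: eq_bigr => i _.
  by rewrite -mulr_sumr A1 mulr1.
- by case=> [|t] j // tT; rewrite pS.
Qed.

Hypotheses (gam : R) (gam0 : 0 <= gam) (Agam : forall t i j, E t j i -> gam <= A t i j)
  (A0 : forall t i j, 0 <= A t i j).

(** Backward along a temporal path, each edge hands over at least the fraction [gam] of the weight
    at its head. *)
Lemma reach_weight (p : nat -> 'I_m -> R) T t j k i :
  (forall t i, 0 <= p t i) ->
  (forall t j, (t < T)%N -> p t j = \sum_i p t.+1 i * A t i j) ->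
  (t + k <= T)%N -> reach E t j k i -> gam ^+ k * p (t + k)%N i <= p t j.
Proof.
move=> p0 pS; elim: k i => [|k IH] i tkT.
  by rewrite addn0 mul1r => /eqP ->.
rewrite addnS in tkT * => /existsP[l /andP[rl El]].
apply: le_trans (IH l (ltnW tkT) rl); rewrite exprSr -mulrA ler_wpM2l ?exprn_ge0//.
rewrite (pS (t + k)%N)// (bigD1 i)//= mulrC.
apply: (@le_trans _ _ (p (t + k).+1 i * A (t + k)%N i l)).
  by rewrite ler_wpM2l// Agam.
by rewrite lerDl sumr_ge0// => ? _; rewrite mulr_ge0.
Qed.

Lemma reach_dist d (z : 'I_m -> nat -> 'rV[R]_d) (r : nat -> R) t j k i :
  (forall s l i, E s l i -> `|z i s.+1 - z l s| <= r s) ->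
  reach E t j k i -> `|z i (t + k)%N - z j t| <= \sum_(s < k) r (t + s)%N.
Proof.
move=> zr; elim: k i => [|k IH] i.
  by rewrite addn0 => /eqP ->; rewrite subrr normr0 big_ord0.
move=> /existsP[l /andP[rl El]]; rewrite big_ord_recr/= addrC addnS.
by rewrite -(subrK (z l (t + k)%N) (z i _)) -addrA (le_trans (ler_normD _ _))// lerD ?zr ?IH.
Qed.

(** A stretch of [m * S] slots links [j] to every agent, so [p t j] is at least [gam ^+ (m * S)]
    times each [p (t + m * S) i], and these sum to 1 over the [m] agents. *)
Lemma absolute_probability_lb S T : (0 < m)%N -> gam <= 1 ->
  (forall t i, E t i i) -> (forall t, strongly_connected (window E S t)) ->
  (forall t i, \sum_j A t i j = 1) ->
  exists p : nat -> 'I_m -> R, [/\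
    forall t i, (t <= T)%N -> gam ^+ (m * S) / m%:R <= p t i,
    forall t, (t <= T)%N -> \sum_i p t i = 1 &
    forall t j, (t < T)%N -> p t j = \sum_i p t.+1 i * A t i j].
Proof.
move=> m0 gam1 Eii sc A1.
have [p [p0 p1 pT pS]] := absolute_probability T m0 A0 A1.
exists p; split=> // t j tT; set B := (m * S)%N.
have mR : 0 < m%:R :> R by rewrite ltr0n.
have [tB|Tt] := leqP (t + B) T.
  have -> : gam ^+ B = \sum_i gam ^+ B * p (t + B)%N i.
    by rewrite -mulr_sumr p1// mulr1.
  rewrite ler_pdivrMr// mulr_natr -[in leRHS](card_ord m) -sumr_const.
  apply: ler_sum => i _.
  exact: (reach_weight p0 pS tB (reach_all _ _ _ Eii sc)).
(* Fewer than [B] slots remain before [T]: [j] waits by self-loops until the horizon, where its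
   weight is [1 / m]. *)
have := @reach_weight p T t j (T - t) j p0 pS; rewrite subnKC// leqnn => /(_ isT).
rewrite pT => h; apply: le_trans (h _); last first.
  by apply: (@reach_le _ _ _ 0) => //=.
rewrite ler_wpM2r ?invr_ge0 ?ler0n// ler_wiXn2l//; lia.
Qed.

End Network.

(** * Summation estimates *)

Section Sequences.
Context {R : realType}.

Lemma ler_sum_ord_widen (F : nat -> R) (n n' : nat) :
  (forall t, 0 <= F t) -> (n <= n')%N -> \sum_(t < n) F t <= \sum_(t < n') F t.
Proof.
move=> F0 /subnKC <-; rewrite big_split_ord/= lerDl.
by apply: sumr_ge0 => i _.
Qed.

Lemma sqr_sum_le (r : nat -> R) (n : nat) :
  (\sum_(s < n) r s) ^+ 2 <= n%:R * \sum_(s < n) r s ^+ 2.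
Proof.
elim: n => [|n IH]; first by rewrite !big_ord0 expr0n mulr0.
rewrite !big_ord_recr/=.
set S := \sum_(_ < n) _ in IH *; set Q := \sum_(_ < n) _ in IH *.
have Q0 : 0 <= Q by apply: sumr_ge0 => i _; exact: sqr_ge0.
have [n0|n0] := posnP n.
  by rewrite /S /Q n0 !big_ord0 !add0r mul1r.
suff : 2 * S * r n <= Q + n%:R * r n ^+ 2 by rewrite -natr1; nra.
have nR : 0 < n%:R :> R by rewrite ltr0n.
rewrite -(ler_pM2l nR).
have := sqr_ge0 (S - n%:R * r n); nra.
Qed.

(** Each [q s] lies in at most [B] windows. The first [B] terms of [d] have no window before them
    and are kept as they are. *)
Lemma window_sum_le (q d : nat -> R) (C : R) (B T : nat) :
  0 <= C -> (forall t, 0 <= q t) -> (forall t, 0 <= d t) ->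
  (forall t, d (t + B)%N <= C * \sum_(s < B) q (t + s)%N) ->
  \sum_(t < T.+1) d t <= \sum_(t < B) d t + C * B%:R * \sum_(s < T) q s.
Proof.
move=> C0 q0 d0 dq.
have Q0 n : 0 <= \sum_(s < n) q s by apply: sumr_ge0.
have [TB|BT] := leqP T.+1 B.
  rewrite (le_trans (ler_sum_ord_widen d0 TB))// lerDl.
  by rewrite !mulr_ge0.
have TE : T.+1 = (B + (T.+1 - B))%N by rewrite subnKC// ltnW.
set N := (T.+1 - B)%N in TE.
rewrite TE big_split_ord/= lerD2l.
apply: (@le_trans _ _ (\sum_(t < N) C * \sum_(s < B) q (t + s)%N)).
  by apply: ler_sum => t _; rewrite addnC.
rewrite -mulr_sumr exchange_big/= -mulrA ler_wpM2l//.
apply: (@le_trans _ _ (\sum_(s < B) \sum_(s < T) q s)).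
  apply: ler_sum => s _.
  apply: (@le_trans _ _ (\sum_(t < s + N) q t)).
    under eq_bigr do rewrite addnC.
    by rewrite big_split_ord/= lerDr Q0.
  by apply: ler_sum_ord_widen => //; have := ltn_ord s; lia.
by rewrite sumr_const card_ord mulr_natl.
Qed.

(** [ln (1 + x) <= x] at [x = - 1 / (T + 2)] compares each new term with an increment of the
    logarithm. *)
Lemma harmonic_sum_le (T : nat) :
  \sum_(t < T.+1) (t.+1)%:R^-1 <= 1 + ln (T.+1)%:R :> R.
Proof.
elim: T => [|T IH]; first by rewrite big_ord1 invr1 ln1 addr0.
rewrite big_ord_recr/=.
have p1 : 0 < T.+1%:R :> R by rewrite ltr0n.
have p2 : 0 < T.+2%:R :> R by rewrite ltr0n.
suff h : T.+2%:R^-1 <= ln T.+2%:R - ln T.+1%:R :> R.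
  by apply: le_trans (lerD IH h) _; rewrite -addrA subrKC.
have := @le_ln1Dx R (- T.+2%:R^-1).
have -> : 1 - T.+2%:R^-1 = T.+1%:R / T.+2%:R :> R.
  have -> : T.+1%:R = T.+2%:R - 1 :> R by rewrite -[T.+2%:R]natr1 addrK.
  by rewrite mulrBl divff ?gt_eqF// mul1r.
rewrite lnM ?posrE ?invr_gt0// lnV ?posrE// ltrN2 invf_lt1// ltr1n => /(_ isT).
by rewrite lerNr opprB.
Qed.

(** All [t + 1] terms are at least the last one, [1 / sqrt (t + 1)]. *)
Lemma sqrt_sum_ge (t : nat) :
  Num.sqrt t%:R <= \sum_(r < t.+1) (Num.sqrt r.+1%:R)^-1 :> R.
Proof.
have s0 : 0 < Num.sqrt t.+1%:R :> R by rewrite sqrtr_gt0 ltr0n.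
apply: (@le_trans _ _ (Num.sqrt t.+1%:R)); first by rewrite ler_sqrt ?ler_nat// ler0n.
have -> : Num.sqrt t.+1%:R = \sum_(r < t.+1) (Num.sqrt t.+1%:R)^-1 :> R.
  rewrite sumr_const card_ord -[RHS]mulr_natl -[in X in X / _](sqr_sqrtr (ler0n _ t.+1)).
  by rewrite expr2 mulfK ?gt_eqF.
apply: ler_sum => r _; rewrite lef_pV2 ?posrE ?sqrtr_gt0 ?ltr0n//.
by rewrite ler_sqrt ?ler0n// ler_nat.
Qed.

(* The dissipation [q] controls [d] on windows of length [B], and is itself
   paid for by [sum alpha d]; absorbing half of [sum d ^ 2] closes the loop. *)
Lemma sum_sqr_disagreement_le (alpha d q : nat -> R) (C2 eta C W K0 : R) :
  0 <= C2 -> 0 < eta ->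
  (forall T, \sum_(t < T.+1) d t ^+ 2 <= K0 + C2 * \sum_(s < T) q s) ->
  (forall T, eta * \sum_(s < T) q s <=
     W + 2 * C * \sum_(t < T) alpha t * d t.+1) ->
  forall T, \sum_(t < T.+1) d t ^+ 2 <=
    2 * (K0 + C2 / eta * W) + 4 * (C2 / eta * C) ^+ 2 * \sum_(t < T) alpha t ^+ 2.
Proof.
move=> C20 eta0 dq qd T; set c := C2 / eta.
have c0 : 0 <= c by rewrite divr_ge0// ltW.
have C2E : C2 = c * eta by rewrite divfK// gt_eqF.
have h1 : C2 * \sum_(s < T) q s <= c * (W + 2 * C * \sum_(t < T) alpha t * d t.+1).
  by rewrite C2E -mulrA ler_wpM2l.
(* Young's inequality, weighted so that the disagreement enters with factor 1/2. *)
have h2 : 2 * (c * C) * \sum_(t < T) alpha t * d t.+1 <=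
    2 * (c * C) ^+ 2 * \sum_(t < T) alpha t ^+ 2 + 2^-1 * \sum_(t < T) d t.+1 ^+ 2.
  rewrite !mulr_sumr -big_split/=; apply: ler_sum => t _.
  have := sqr_ge0 (2 * (c * C) * alpha t - d t.+1).
  by set x := c * C; nra.
have h3 : \sum_(t < T.+1) d t ^+ 2 = d 0%N ^+ 2 + \sum_(t < T) d t.+1 ^+ 2.
  by rewrite big_ord_recl.
have := dq T; have := sqr_ge0 (d 0%N); rewrite h3.
by nra.
Qed.

(** The rate argument, freed of vectors. [F i t] stands for the objective gap of agent [i], and [G]
    for the average gap under weights that depend on the horizon, hence its place after [T]. The
    energy bounds [sum alpha G] above, and [F - d <= G] passes this to each agent. *)
Lemma weighted_gap_bound (I : Type) (alpha d q : nat -> R) (F : I -> nat -> R)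
    (C2 eta C W K0 M k2 : R) :
  0 <= C2 -> 0 < eta -> 0 <= C -> (forall t, 0 < alpha t) ->
  (forall t, alpha t.+1 <= alpha t) ->
  (forall t, alpha t <= k2 / Num.sqrt t.+1%:R) ->
  (forall t, 0 <= q t) -> (forall t, 0 <= d t) ->
  (forall i, `|F i 0%N| <= M) ->
  (forall T, \sum_(t < T.+1) d t ^+ 2 <= K0 + C2 * \sum_(s < T) q s) ->
  (forall T, exists G : nat -> R,
    eta * \sum_(s < T) q s + 2 * \sum_(t < T) alpha t * G t <= W /\
    forall t, (t < T)%N -> - (C * d t.+1) <= G t /\
      forall i, F i t.+1 - d t.+1 <= G t) ->
  (forall i t, - (C * d t.+1) <= F i t.+1) ->
  exists K, forall i T, (0 < T)%N ->
    `|\sum_(r < T.+1) alpha r * F i r| <= K * ln T.+1%:R.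
Proof.
move=> C20 eta0 C0 al0 alS alk q0 d0 FM dq energy FC.
have qd T : eta * \sum_(s < T) q s <= W + 2 * C * \sum_(t < T) alpha t * d t.+1.
  have [G [GW GF]] := energy T.
  suff : - (C * \sum_(t < T) alpha t * d t.+1) <= \sum_(t < T) alpha t * G t by lra.
  rewrite mulr_sumr -sumrN; apply: ler_sum => t _.
  have [GC _] := GF t (ltn_ord t); rewrite mulrCA -mulrN.
  by rewrite ler_wpM2l// ltW.
have dal := sum_sqr_disagreement_le C20 eta0 dq qd.
set a0 := 2 * _ in dal; set a1 := 4 * _ in dal.
have a10 : 0 <= a1 by rewrite mulr_ge0// sqr_ge0.
pose P T := \sum_(t < T.+1) alpha t ^+ 2.
pose D T := \sum_(t < T.+1) d t ^+ 2.
have P0 T : 0 <= P T by apply: sumr_ge0 => t _; exact: sqr_ge0.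
have Pln T : P T <= k2 ^+ 2 * (1 + ln T.+1%:R).
  apply: (@le_trans _ _ (k2 ^+ 2 * \sum_(t < T.+1) t.+1%:R^-1)); last first.
    by rewrite ler_wpM2l ?sqr_ge0// harmonic_sum_le.
  rewrite mulr_sumr; apply: ler_sum => t _.
  rewrite -[t.+1%:R](sqr_sqrtr (ler0n _ t.+1)) -exprVn -exprMn.
  rewrite ler_sqr ?nnegrE ?(ltW (al0 _))// (le_trans (ltW (al0 t)))//.
have DP T : D T <= `|a0| + a1 * P T.
  rewrite (le_trans (dal T))// lerD ?ler_norm// ler_wpM2l//.
  by apply: (@ler_sum_ord_widen (fun t => alpha t ^+ 2)) => // t; exact: sqr_ge0.
have ln0 T : (0 < T)%N -> ln 2 <= ln T.+1%:R :> R.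
  by move=> T0; rewrite ler_ln ?posrE ?ltr0n// ler_nat.
have l2 : 0 < ln 2 :> R by rewrite ln_gt0// ltr1n.
pose Z0 := `|a0| + (a1 + 1) * (k2 ^+ 2).
pose Z1 := (a1 + 1) * (k2 ^+ 2).
have PD T : P T + D T <= Z0 + Z1 * ln T.+1%:R.
  have := DP T; have := Pln T; rewrite /Z0 /Z1 => h1 h2.
  have : (a1 + 1) * P T <= (a1 + 1) * (k2 ^+ 2 * (1 + ln T.+1%:R)).
    by rewrite ler_wpM2l// addr_ge0.
  by nra.
have xy (x y : R) : x * y <= x ^+ 2 + y ^+ 2 by nra.
have D1 T : \sum_(t < T) d t.+1 ^+ 2 <= D T.
  by rewrite /D big_ord_recl lerDr sqr_ge0.
have P1 T : \sum_(t < T) alpha t.+1 ^+ 2 <= P T.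
  by rewrite /P big_ord_recl lerDr sqr_ge0.
have P2 T : \sum_(t < T) alpha t ^+ 2 <= P T.
  by apply: (@ler_sum_ord_widen (fun t => alpha t ^+ 2)) => // t; exact: sqr_ge0.
have S1 T : \sum_(t < T) alpha t.+1 * d t.+1 <= P T + D T.
  apply: le_trans (lerD (P1 T) (D1 T)); rewrite -big_split/=.
  by apply: ler_sum => t _; exact: xy.
have S2 T : \sum_(t < T) alpha t * d t.+1 <= P T + D T.
  apply: le_trans (lerD (P2 T) (D1 T)); rewrite -big_split/=.
  by apply: ler_sum => t _; exact: xy.
pose b := alpha 0%N * M + `|W| + (C + 1) * Z0.
have bound i T : `|\sum_(r < T.+1) alpha r * F i r| <=
    alpha 0%N * M + `|W| + (C + 1) * (P T + D T).
  (* The lower bound on [F] starts at slot 1, so slot 0 is split off and bounded through [M]. *)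
  rewrite big_ord_recl/= (le_trans (ler_normD _ _))// -addrA lerD//.
    by rewrite normrM (gtr0_norm (al0 _)) ler_wpM2l// ltW.
  have PD0 : 0 <= P T + D T by rewrite addr_ge0// sumr_ge0// => t _; exact: sqr_ge0.
  rewrite ler_norml; apply/andP; split.
    apply: (@le_trans _ _ (- (C * \sum_(t < T) alpha t.+1 * d t.+1))).
      have : C * \sum_(t < T) alpha t.+1 * d t.+1 <= C * (P T + D T) by rewrite ler_wpM2l.
      by have := normr_ge0 W; nra.
    rewrite mulr_sumr -sumrN; apply: ler_sum => t _; rewrite mulrCA -mulrN.
    by rewrite ler_wpM2l// ltW.
  have [G [GW GF]] := energy T.
  apply: (@le_trans _ _ (\sum_(t < T) alpha t * (G t + (C + 1) * d t.+1))).
    apply: ler_sum => t _; have [GC GFt] := GF t (ltn_ord t).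
    have FCt := FC i t; have := GFt i; have := d0 t.+1.
    have := al0 t.+1; have := alS t; have := al0 t => h1 h2 h3 h4 h5.
    (* Adding [C * d] makes the factor nonnegative, so [alpha t.+1] can be raised to [alpha t], the
       weight that [energy] carries. *)
    apply: (@le_trans _ _ (alpha t.+1 * (F i t.+1 + C * d t.+1))).
      by rewrite ler_wpM2l ?lerDl ?mulr_ge0// ltW.
    apply: (@le_trans _ _ (alpha t * (F i t.+1 + C * d t.+1))).
      by rewrite ler_wpM2r//; lra.
    by rewrite ler_wpM2l//; lra.
  have -> : \sum_(t < T) alpha t * (G t + (C + 1) * d t.+1) =
      \sum_(t < T) alpha t * G t + (C + 1) * \sum_(t < T) alpha t * d t.+1.
    by rewrite mulr_sumr -big_split/=; apply: eq_bigr => t _; ring.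
  rewrite lerD// ?ler_wpM2l ?addr_ge0//.
  have : 0 <= eta * \sum_(s < T) q s by rewrite mulr_ge0 ?sumr_ge0// ltW.
  by have := ler_norm W; have := normr_ge0 W; lra.
(* For [T >= 1], [ln 2 <= ln (T + 1)] turns the constant [b] into a multiple of the logarithm. *)
exists (`|b| / ln 2 + (C + 1) * Z1) => i T T0.
apply: le_trans (bound i T) _.
apply: (@le_trans _ _ (`|b| + (C + 1) * Z1 * ln T.+1%:R)).
  have : (C + 1) * (P T + D T) <= (C + 1) * (Z0 + Z1 * ln T.+1%:R).
    by rewrite ler_wpM2l ?addr_ge0.
  by have := ler_norm b; rewrite {1}/b; lra.
rewrite [leRHS]mulrDl lerD2r -{1}[`|b|](divfK (lt0r_neq0 l2)).
by rewrite ler_wpM2l ?divr_ge0 ?ln0// ltW.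
Qed.

End Sequences.

(** * Geometry of the epigraphic problem *)

Section Problem.
Context {R : realType} {n m : nat}.

(** Stands in for a maximum of constants over a finite list of agents or sampled parameters. *)
Lemma uniform_bound (T : eqType) (s : seq T) (P : T -> R -> Prop) :
  (forall x L L', P x L -> L <= L' -> P x L') ->
  (forall x, x \in s -> exists L, P x L) ->
  exists L, forall x, x \in s -> P x L.
Proof.
move=> mono; elim: s => [|a s IH] Ps; first by exists 0.
have [L1 H1] : exists L, P a L by apply: Ps; rewrite mem_head.
have [|L2 H2] := IH; first by move=> x xs; apply: Ps; rewrite inE xs orbT.
exists (Num.max L1 L2) => x; rewrite inE => /orP[/eqP->|/H2 /mono]; last first.
  by apply; rewrite le_max lexx orbT.
by apply: mono H1 _; rewrite le_max lexx.
Qed.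

Lemma f0E (th : 'rV[R]_(n + m)) :
  f0 th = m%:R^-1 * \sum_k upart th 0 k.
Proof.
rewrite /f0 /dotv /cvec big_split_ord/= big1 ?add0r; last first.
  by move=> k _; rewrite row_mxEl mxE mul0r.
by rewrite mulr_sumr; apply: eq_bigr => k _; rewrite row_mxEr !mxE.
Qed.

Lemma upart_norm (th : 'rV[R]_(n + m)) i : `|upart th 0 i| <= `|th|.
Proof. by rewrite mxE ler_coord_norm. Qed.

Lemma xpart_norm (th : 'rV[R]_(n + m)) : `|xpart th| <= `|th|.
Proof. by apply: rV_norm_le => // i; rewrite mxE ler_coord_norm. Qed.

Lemma upartB (th th' : 'rV[R]_(n + m)) : upart (th - th') = upart th - upart th'.
Proof. by apply/rowP => i; rewrite !mxE. Qed.

Lemma xpartB (th th' : 'rV[R]_(n + m)) : xpart (th - th') = xpart th - xpart th'.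
Proof. by apply/rowP => i; rewrite !mxE. Qed.

Hypothesis m0 : (0 < m)%N.

Lemma mean_le (u : 'I_m -> R) (b : R) :
  (forall i, u i <= b) -> m%:R^-1 * \sum_i u i <= b.
Proof.
move=> ub; have mR : 0 < m%:R :> R by rewrite ltr0n.
rewrite mulrC ler_pdivrMr// mulr_natr -[in leRHS](card_ord m) -sumr_const.
exact: ler_sum.
Qed.

Lemma f0_lipschitz (th th' : 'rV[R]_(n + m)) : f0 th - f0 th' <= `|th - th'|.
Proof.
rewrite !f0E -mulrBr -sumrB; apply: mean_le => i.
have := upart_norm (th - th') i; rewrite upartB mxE [in X in `|_ + X| <= _]mxE.
by apply: le_trans; exact: ler_norm.
Qed.

Variables (X : set 'rV[R]_n) (f : 'I_m -> 'rV[R]_n -> R)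
  (g : 'I_m -> 'rV[R]_n -> R -> R) (Yk : 'I_m -> seq R) (eps : 'I_m -> R).
Local Notation Om_i := (Omega_i X f g Yk eps).
Local Notation Om := (Omega X f g Yk eps).
Hypotheses (cX : convex_setv X) (cf : forall i, convex_fun (f i))
  (cg : forall i y, y \in Yk i -> convex_fun (fun x => g i x y)).

Lemma Omega_i_convex i : convex_setv (Om_i i).
Proof.
move=> a b [Xa [fa ga]] [Xb [fb gb]] l l01.
have [/andP[l0 l1] _] := (l01, tt).
have xE : xpart (l *: a + (1 - l) *: b) = l *: xpart a + (1 - l) *: xpart b.
  by apply/rowP => k; rewrite !mxE.
have uE : upart (l *: a + (1 - l) *: b) 0 i
    = l * upart a 0 i + (1 - l) * upart b 0 i.
  by rewrite !mxE.
split; first by rewrite xE; exact: cX.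
split.
  rewrite uE xE; have := cf i (xpart a) (xpart b) l01.
  have := convex_comb_le l01 fa fb; lra.
move=> y yY; rewrite xE (le_trans (cg yY _ _ l01))//.
by apply: convex_comb_le => //; [exact: ga|exact: gb].
Qed.

Variables (rho : R) (xt : 'rV[R]_n).
Hypotheses (Xrho : forall x : 'rV[R]_n, X x -> `|x| <= rho) (Xxt : X xt)
  (slater : forall i y, y \in Yk i -> g i xt y < - eps i).

Lemma slater_slack : exists s, 0 < s /\
  forall i y, y \in Yk i -> g i xt y <= - eps i - s.
Proof.
(* [uniform_bound] yields large constants, so a slack is recorded by its reciprocal [L]. *)
pose P (p : 'I_m * R) (L : R) := 0 < L /\ L^-1 <= - eps p.1 - g p.1 xt p.2.
have mono p L L' : P p L -> L <= L' -> P p L'.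
  move=> [L0 Ls] LL'; have L'0 := lt_le_trans L0 LL'; split=> //.
  by apply: le_trans Ls; rewrite lef_pV2.
have [i|i _|L HL] := @uniform_bound _ (enum 'I_m)
    (fun i L => 0 < L /\ forall y, y \in Yk i -> P (i, y) L).
- move=> L L' [L0 PL] LL'; split; first exact: lt_le_trans LL'.
  by move=> y /PL /mono; apply.
- have [y L L'|y yY|L HL] := @uniform_bound _ (Yk i) (fun y => P (i, y)).
  + exact: mono.
  + exists (- eps i - g i xt y)^-1; rewrite /P invr_gt0 invrK/= lexx.
    by rewrite subr_gt0 slater.
  (* The maximum with 1 keeps the constant positive when [Yk i] is empty. *)
  exists (Num.max L 1); split; first by rewrite lt_max ltr01 orbT.
  by move=> y /HL /mono; apply; rewrite le_max lexx.
exists (Num.max L 1)^-1; split; first by rewrite invr_gt0 lt_max ltr01 orbT.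
move=> i y yY; have [_ /(_ _ yY) /mono /(_ (_ : L <= Num.max L 1))] := HL i (mem_enum _ i).
by rewrite le_max lexx => /(_ isT)[_ /=]; lra.
Qed.

Definition lipschitz_on (L : R) (h : 'rV[R]_n -> R) :=
  0 <= L /\ forall x y : 'rV[R]_n, `|x| <= rho -> `|y| <= rho ->
    h x - h y <= L * `|x - y|.

Lemma uniform_lipschitz : exists L, forall i, lipschitz_on L (f i) /\
  forall y, y \in Yk i -> lipschitz_on L (fun x => g i x y).
Proof.
have mono L L' h : lipschitz_on L h -> L <= L' -> lipschitz_on L' h.
  move=> [L0 HL] LL'; split; first exact: le_trans LL'.
  by move=> x y xr yr; rewrite (le_trans (HL _ _ xr yr))// ler_wpM2r.
have [i|i _|L HL] := @uniform_bound _ (enum 'I_m) (fun i L =>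
  lipschitz_on L (f i) /\ forall y, y \in Yk i -> lipschitz_on L (fun x => g i x y)).
- move=> L L' [h1 h2] LL'; split; first exact: mono LL'.
  by move=> y /h2 /mono; apply.
- have [L1 H1] := convex_fun_lipschitz rho (cf i).
  have [y L L'|y yY|L2 H2] := @uniform_bound _ (Yk i)
      (fun y L => lipschitz_on L (fun x => g i x y)).
  + exact: mono.
  + exact: convex_fun_lipschitz (cg yY).
  exists (Num.max L1 L2); split; first by apply: mono H1 _; rewrite le_max lexx.
  by move=> y /H2 /mono; apply; rewrite le_max lexx orbT.
by exists L => i; apply: HL; rewrite mem_enum.
Qed.

(* Moving the [x]-part towards the Slater point by a fraction proportional to
   the disagreement [D] restores every constraint violated by [z i]. *)
Lemma feasible_near : exists C, 0 <= C /\
  forall (z : 'I_m -> 'rV[R]_(n + m)) (D : R),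
    (forall j, Om_i j (z j)) -> (forall i j, `|z i - z j| <= D) ->
    forall i, exists2 w, Om w & f0 w <= f0 (z i) + C * D.
Proof.
have [s [s0 slack]] := slater_slack.
have [L HL] := uniform_lipschitz.
have L0 : 0 <= L by have [[]] := HL (Ordinal m0).
have rho0 : 0 <= rho := le_trans (normr_ge0 _) (Xrho Xxt).
(* Raising [u] by [C * D] pays for the disagreement of the [u] parts (1), that of the [x] parts
   ([L]), and the move towards the Slater point ([2 * rho * L ^+ 2 / s]). *)
pose C := 1 + L + 2 * rho * L ^+ 2 / s.
have C0 : 0 <= C by rewrite !addr_ge0 ?mulr_ge0 ?invr_ge0 ?exprn_ge0// ltW.
exists C; split=> // z D Oz zD i.
have D0 : 0 <= D := le_trans (normr_ge0 _) (zD i i).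
have LD0 : 0 <= L * D by rewrite mulr_ge0.
(* Solves [l * s = (1 - l) * (L * D)]: the slack gained from the Slater point equals the violation
   that remains. *)
pose l := L * D / (L * D + s).
have lE : l * (L * D + s) = L * D by rewrite divfK// gt_eqF// ltr_wpDl.
have l01 : 0 <= l <= 1.
  rewrite divr_ge0 ?addr_ge0 ?(ltW s0)//= ler_pdivrMr ?ltr_wpDl//.
  by rewrite mul1r lerDl ltW.
have ls : l <= L * D / s.
  by rewrite ler_pdivlMr//; nra.
pose x' := l *: xt + (1 - l) *: xpart (z i).
pose w : 'rV[R]_(n + m) := row_mx x' (upart (z i) + const_mx (C * D)).
have xw : xpart w = x' by rewrite /xpart row_mxKl.
have uw k : upart w 0 k = upart (z i) 0 k + C * D.
  by rewrite /upart row_mxKr !mxE.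
have Xi j : X (xpart (z j)) by have [] := Oz j.
have xD j : `|xpart (z i) - xpart (z j)| <= D.
  by rewrite -xpartB (le_trans (xpart_norm _)).
exists w; last first.
  rewrite !f0E; under eq_bigr do rewrite uw.
  rewrite big_split/= mulrDr sumr_const card_ord lerD2l -[X in _ * X]mulr_natl.
  by rewrite mulKf// pnatr_eq0 -lt0n.
move=> j; have [[_ fL] gL] := HL j; have [Xj [fj gj]] := Oz j.
split; first by rewrite xw; exact: cX.
split; last first.
  move=> y yY; rewrite xw (le_trans (cg yY _ _ l01))//.
  have [_ /(_ _ _ (Xrho (Xi i)) (Xrho (Xi j))) gl] := gL _ yY.
  have := slack _ _ yY; have := gj _ yY.
  have : L * `|xpart (z i) - xpart (z j)| <= L * D by rewrite ler_wpM2l.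
  move: l01 gl lE => /andP[l0 l1].
  set G1 := g j xt y; set G2 := g j (xpart (z i)) y; set G3 := g j _ y.
  set N := L * `|_|; set E := eps j; set Q := L * D => gl lE NQ G3E G1E.
  have h1 : l * G1 <= l * (- E - s) by rewrite ler_wpM2l.
  have h2 : (1 - l) * G2 <= (1 - l) * (- E + Q) by rewrite ler_wpM2l; lra.
  by lra.
rewrite xw uw.
have h1 := cf j xt (xpart (z i)) l01.
have h2 := fL _ _ (Xrho Xxt) (Xrho (Xi i)).
have h3 := fL _ _ (Xrho (Xi i)) (Xrho (Xi j)).
have h4 : L * `|xpart (z i) - xpart (z j)| <= L * D by rewrite ler_wpM2l.
have h5 : L * `|xt - xpart (z i)| <= L * (2 * rho).
  rewrite ler_wpM2l// (le_trans (ler_normB _ _))//.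
  by have := Xrho Xxt; have := Xrho (Xi i); lra.
have h6 : upart (z j) 0 j - upart (z i) 0 j <= D.
  have := upart_norm (z j - z i) j; rewrite upartB mxE [in X in `|_ + X| <= _]mxE.
  by move=> /(le_trans (ler_norm _)) /le_trans; apply.
have h7 : l * (f j xt - f j (xpart (z i))) <= 2 * rho * L ^+ 2 / s * D.
  have /andP[l0 _] := l01.
  apply: (@le_trans _ _ (l * (L * (2 * rho)))); first by rewrite ler_wpM2l//; lra.
  rewrite (_ : _ / s * D = L * D / s * (L * (2 * rho))); last by ring.
  by rewrite ler_wpM2r// !mulr_ge0.
rewrite -/x' in h1; rewrite /C.
by lra.
Qed.

(** Near-minimizers replace a minimizer. They are bounded independently of [del], because [u] can be
    lowered to the values [f i x], which are bounded on [X]; this later gives one bound on the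
    initial energy. *)
Lemma f0star_properties : (forall w, Om w -> f0star X f g Yk eps <= f0 w) /\
  exists r, forall del, 0 < del ->
    exists w, [/\ Om w, f0 w <= f0star X f g Yk eps + del & `|w| <= r].
Proof.
have [L HL] := uniform_lipschitz.
have L0 : 0 <= L by have [[]] := HL (Ordinal m0).
have rho0 : 0 <= rho := le_trans (normr_ge0 _) (Xrho Xxt).
pose M := \sum_i `|f i xt| + L * (2 * rho).
have fM i x : X x -> `|f i x| <= M.
  move=> Xx; have [[_ fL] _] := HL i.
  have h1 := fL _ _ (Xrho Xxt) (Xrho Xx); have h2 := fL _ _ (Xrho Xx) (Xrho Xxt).
  have h3 : L * `|xt - x| <= L * (2 * rho).
    rewrite ler_wpM2l// (le_trans (ler_normB _ _))//.
    by have := Xrho Xxt; have := Xrho Xx; lra.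
  rewrite distrC in h2.
  have h4 : `|f i xt| <= \sum_i `|f i xt|.
    by rewrite (bigD1 i)//= lerDl sumr_ge0.
  rewrite /M; move: h4; rewrite ler_norml => /andP[? ?].
  by rewrite ler_norml; apply/andP; split; lra.
pose lift (x : 'rV[R]_n) : 'rV[R]_(n + m) := row_mx x (\row_i f i x).
have xl x : xpart (lift x) = x by rewrite /xpart row_mxKl.
have ul x i : upart (lift x) 0 i = f i x by rewrite /upart row_mxKr mxE.
have Olift x : X x -> (forall i y, y \in Yk i -> g i x y <= - eps i) -> Om (lift x).
  by move=> Xx gx i; do 2?split; rewrite !xl ?ul ?subrr//; exact: gx.
pose S := [set f0 th | th in Om].
have lbS : has_lbound S.
  exists (- M) => _ [w Ow <-]; rewrite f0E lerNl -mulrN -sumrN; apply: mean_le => i.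
  have [Xw [fw _]] := Ow i; have := fM i _ Xw; rewrite ler_norml => /andP[? _].
  by lra.
have S0 : S !=set0.
  exists (f0 (lift xt)), (lift xt) => //; apply: Olift => // i y yY.
  exact/ltW/slater.
split; first by move=> w Ow; apply: ge_inf => //; exists w.
exists (rho + M) => del del0.
have [_ [w Ow <-] lt] := inf_adherent del0 (conj S0 lbS).
have Xw : X (xpart w) by have [] := Ow (Ordinal m0).
exists (lift (xpart w)); split.
- by apply: Olift => // i y yY; have [_ [_]] := Ow i; apply.
- apply: le_trans (ltW lt); rewrite !f0E ler_wpM2l ?invr_ge0//.
  by apply: ler_sum => i _; rewrite ul; have [_ [+ _]] := Ow i; rewrite subr_le0.
have M0 : 0 <= M := le_trans (normr_ge0 _) (fM (Ordinal m0) _ Xxt).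
apply: rV_norm_le => [|k]; first by rewrite addr_ge0.
case: (split_ordP k) => j ->; rewrite /lift ?row_mxEl ?row_mxEr; last first.
  by rewrite mxE (le_trans (fM _ _ Xw))// lerDr.
by rewrite (le_trans (ler_coord_norm _ _))// (le_trans (Xrho Xw))// lerDl.
Qed.

End Problem.

(** * Energy of the iteration *)

Section Iteration.
Context {R : realType} {d m : nat}.
Variables (E : nat -> rel 'I_m) (A : nat -> 'M[R]_m) (z : 'I_m -> nat -> 'rV[R]_d).
Hypotheses (A0 : forall t i j, 0 <= A t i j) (A1 : forall t i, \sum_j A t i j = 1).

Definition dissipation (t : nat) : R :=
  \sum_i \sum_j A t i j * sqnorm (z j t - z i t.+1).

Definition disagreement (t : nat) : R := \sum_i \sum_j `|z i t - z j t|.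

Lemma dissipation_ge0 t : 0 <= dissipation t.
Proof.
by apply: sumr_ge0 => i _; apply: sumr_ge0 => j _; rewrite mulr_ge0// sqnorm_ge0.
Qed.

Lemma disagreement_ge0 t : 0 <= disagreement t.
Proof. by apply: sumr_ge0 => i _; exact: sumr_ge0. Qed.

Lemma dist_le_disagreement t i j : `|z i t - z j t| <= disagreement t.
Proof.
rewrite /disagreement (bigD1 i)//= (bigD1 j)//= -addrA lerDl addr_ge0//.
  exact: sumr_ge0.
by apply: sumr_ge0 => k _; exact: sumr_ge0.
Qed.

(** Temporal paths from one agent at slot [t] reach everyone at [t + B], and an edge, having weight
    at least [gam], is no longer than [sqrt (dissipation / gam)]. Two paths join any pair;
    Cauchy-Schwarz over the [B] slots bounds the square. *)
Lemma disagreement_sqr_le (gam : R) (B t : nat) : (0 < m)%N -> 0 < gam ->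
  (forall t i j, E t j i -> gam <= A t i j) ->
  (forall j i, reach E t j B i) ->
  disagreement (t + B) ^+ 2 <=
    (2 * m%:R ^+ 2) ^+ 2 * B%:R / gam * \sum_(s < B) dissipation (t + s).
Proof.
move=> m0 gam0 Agam full.
pose r s := Num.sqrt (dissipation s / gam).
have r2 s : r s ^+ 2 = dissipation s / gam.
  by rewrite sqr_sqrtr// divr_ge0 ?dissipation_ge0// ltW.
have edge s l i : E s l i -> `|z i s.+1 - z l s| <= r s.
  move=> El; rewrite -ler_sqr ?nnegrE ?sqrtr_ge0// r2 distrC.
  rewrite (le_trans (norm_sqr_le_sqnorm _))// ler_pdivlMr// mulrC.
  apply: (@le_trans _ _ (A s i l * sqnorm (z l s - z i s.+1))).
    by rewrite ler_wpM2r ?sqnorm_ge0// Agam.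
  have t0 i' j' : 0 <= A s i' j' * sqnorm (z j' s - z i' s.+1).
    by rewrite mulr_ge0// sqnorm_ge0.
  rewrite /dissipation (bigD1 i)//= (bigD1 l)//= -addrA lerDl addr_ge0 ?sumr_ge0//.
  by move=> k _; exact: sumr_ge0.
set Q := \sum_(s < B) dissipation _.
pose S := \sum_(s < B) r (t + s)%N.
have S0 : 0 <= S by apply: sumr_ge0 => s _; exact: sqrtr_ge0.
have zS i : `|z i (t + B)%N - z (Ordinal m0) t| <= S.
  exact: (reach_dist edge (full _ _)).
have dS : disagreement (t + B) <= 2 * m%:R ^+ 2 * S.
  have -> : 2 * m%:R ^+ 2 * S = \sum_(i < m) \sum_(j < m) (S + S).
    by rewrite !sumr_const !card_ord -mulrnA -[RHS]mulr_natr natrM; ring.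
  apply: ler_sum => i _; apply: ler_sum => j _.
  rewrite -(subrKA (z (Ordinal m0) t)) (le_trans (ler_normD _ _))// lerD//.
  by rewrite distrC.
have S2 : S ^+ 2 <= B%:R * (gam^-1 * Q).
  rewrite (le_trans (sqr_sum_le (fun s => r (t + s)%N) B))// ler_wpM2l//.
  by rewrite mulr_sumr; apply: ler_sum => s _; rewrite r2 mulrC.
apply: (@le_trans _ _ ((2 * m%:R ^+ 2 * S) ^+ 2)).
  by rewrite ler_sqr ?nnegrE ?disagreement_ge0 ?mulr_ge0 ?exprn_ge0.
rewrite exprMn -[leRHS]mulrA -[leRHS]mulrA ler_wpM2l ?sqr_ge0//.
Qed.

(** The [p t]-weighted squared distance [V t] to [w] serves as Lyapunov function: averaging
    [proj_step] with [p t.+1] reproduces [V t], because [p t] is the pullback of [p t.+1] through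
    [A t]. *)
Lemma energy_decrease (K : 'I_m -> set 'rV[R]_d) (c w : 'rV[R]_d)
    (alpha : nat -> R) (p : nat -> 'I_m -> R) (eta : R) (T : nat) :
  (forall i, convex_setv (K i)) -> (forall i, K i w) ->
  (forall i t, is_proj (K i) (\sum_j A t i j *: z j t - alpha t *: c) (z i t.+1)) ->
  0 <= eta -> (forall t i, (t <= T)%N -> eta <= p t i) ->
  (forall t j, (t < T)%N -> p t j = \sum_i p t.+1 i * A t i j) ->
  eta * \sum_(t < T) dissipation t
    + 2 * \sum_(t < T) alpha t * \sum_i p t.+1 i * dotv c (z i t.+1 - w)
  <= \sum_i p 0%N i * sqnorm (z i 0%N - w).
Proof.
move=> cK Kw proj eta0 pl pS.
pose V t := \sum_i p t i * sqnorm (z i t - w).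
(* Keeping [V t] on the left makes the induction telescope; at [T] it is nonnegative and dropped. *)
suff H t : (t <= T)%N -> eta * \sum_(s < t) dissipation s
    + 2 * \sum_(s < t) alpha s * \sum_i p s.+1 i * dotv c (z i s.+1 - w) + V t
    <= V 0%N.
  apply: le_trans (H T (leqnn T)); rewrite lerDl sumr_ge0// => i _.
  by rewrite mulr_ge0 ?sqnorm_ge0// (le_trans eta0) ?pl.
elim: t => [|t IH] tT; first by rewrite !big_ord0 !mulr0 !add0r.
apply: le_trans (IH (ltnW tT)); rewrite !big_ord_recr/=.
suff : V t.+1 <= V t - eta * dissipation t
    - 2 * (alpha t * \sum_i p t.+1 i * dotv c (z i t.+1 - w)) by lra.
have -> : V t = \sum_i p t.+1 i * \sum_j A t i j * sqnorm (z j t - w).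
  rewrite /V; under eq_bigr => j _ do rewrite pS// mulr_suml.
  rewrite exchange_big/=; apply: eq_bigr => i _; rewrite mulr_sumr.
  by apply: eq_bigr => j _; rewrite mulrA.
apply: (@le_trans _ _ (\sum_i p t.+1 i * (\sum_j A t i j * sqnorm (z j t - w)
   - \sum_j A t i j * sqnorm (z j t - z i t.+1)
   - 2 * alpha t * dotv c (z i t.+1 - w)))).
  apply: ler_sum => i _; rewrite ler_wpM2l ?(le_trans eta0) ?pl//.
  exact: (proj_step (A1 t i) (cK i) (proj i t) (Kw i)).
rewrite /dissipation !mulr_sumr -!sumrB; apply: ler_sum => i _.
have : eta * \sum_j A t i j * sqnorm (z j t - z i t.+1) <=
    p t.+1 i * \sum_j A t i j * sqnorm (z j t - z i t.+1).
  rewrite ler_wpM2r ?pl// sumr_ge0// => j _.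
  by rewrite mulr_ge0// sqnorm_ge0.
by lra.
Qed.

End Iteration.

(** * Convergence rate of the averaged iterates *)

Unset Implicit Arguments.

Theorem theorem2 (R : realType) (n m : nat)
  (E : nat -> rel 'I_m) (A : nat -> 'M[R]_m)
  (X : set 'rV[R]_n) (f : 'I_m -> 'rV[R]_n -> R)
  (Y : 'I_m -> set R) (g : 'I_m -> 'rV[R]_n -> R -> R)
  (Yk : 'I_m -> seq R) (eps : 'I_m -> R)
  (alpha : nat -> R) (theta : 'I_m -> nat -> 'rV[R]_(n + m)) :
  (0 < m)%N ->
  UJSC E -> weight_rules E A ->
  X !=set0 -> compact X -> convex_setv X ->
  (forall i, convex_fun (f i)) ->
  (forall i, Y i !=set0 /\ compact (Y i) /\ convex_setR (Y i)) ->
  (forall i, {within X `*` Y i, continuous (fun p : 'rV[R]_n * R => g i p.1 p.2)}) ->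
  (forall i y, Y i y -> convex_fun (fun x => g i x y)) ->
  (forall i y, y \in Yk i -> Y i y) ->
  (forall i, 0 < eps i) ->
  (exists xt, X xt /\ forall i y, y \in Yk i -> g i xt y < - eps i) ->
  (forall t, 0 < alpha t) ->
  (forall t, alpha t.+1 <= alpha t) ->
  (exists k1 k2 : R, 0 < k1 <= k2 /\ forall t : nat,
      k1 / Num.sqrt (t.+1)%:R <= alpha t <= k2 / Num.sqrt (t.+1)%:R) ->
  (forall i t, is_proj (Omega_i X f g Yk eps i)
      (\sum_(j < m) A t i j *: theta j t - alpha t *: cvec R n m) (theta i t.+1)) ->
  exists K : R, forall (i : 'I_m) (t : nat), (1 <= t)%N ->
    `| f0 (theta_hat alpha (theta i) t) - f0star X f g Yk eps |
      <= K * ln (t.+1)%:R / Num.sqrt t%:R.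
Proof.
move=> m0 [S [_ sc]] [Apos Azero A1 Eii [gam [/andP[gam0 gam1] Agam]]] _ cptX cX cf _ _ cgY
  YkY _ [xt [Xxt slater]] al0 alS [k1 [k2 [/andP[k10 _] alk]]] proj.
have cg i y : y \in Yk i -> convex_fun (fun x => g i x y).
  by move=> /YkY /cgY.
have A0 t i j : 0 <= A t i j.
  by case: (boolP (E t j i)) => [/Apos/ltW//|/Azero ->].
have AE t i j : E t j i -> gam <= A t i j by move=> /Apos /Agam.
have [rho Xrho] : exists rho, forall x : 'rV[R]_n, X x -> `|x| <= rho.
  have [M [_ HM]] := compact_bounded cptX.
  by exists (M + 1) => x Xx; apply: HM => //; rewrite ltrDl.
have [C [C0 near]] := feasible_near m0 cX cf cg Xrho Xxt slater.
have [fstar_le [rw near_min]] := f0star_properties m0 cf cg Xrho Xxt slater.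
set fstar := f0star X f g Yk eps in fstar_le near_min *.
pose B := (m * S)%N; pose eta := gam ^+ B / m%:R.
have eta0 : 0 < eta by rewrite divr_gt0 ?exprn_gt0 ?ltr0n.
pose q := dissipation A theta; pose dd := disagreement theta.
pose F i t := f0 (theta i t) - fstar.
(* Projection places the iterates in their sets [Omega_i] from slot 1 on; a nearby point of [Omega]
   then has value at least [fstar]. *)
have FC i t : - (C * dd t.+1) <= F i t.+1.
  have Oth j : Omega_i X f g Yk eps j (theta j t.+1) by have [] := proj j t.
  have [w Ow fw] := near (fun j => theta j t.+1) _ Oth (dist_le_disagreement _ _) i.
  by have := fstar_le w Ow; rewrite /F /dd; lra.
have q0 t : 0 <= q t := dissipation_ge0 _ A0 t.
have d0 t : 0 <= dd t := disagreement_ge0 _ t.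
pose C1 := (2 * m%:R ^+ 2) ^+ 2 * B%:R / gam.
have C10 : 0 <= C1 by rewrite divr_ge0 ?mulr_ge0 ?sqr_ge0// ltW.
have dq T : \sum_(t < T.+1) dd t ^+ 2 <=
    \sum_(t < B) dd t ^+ 2 + C1 * B%:R * \sum_(s < T) q s.
  apply: (window_sum_le (d := fun t => dd t ^+ 2)) => // t; first exact: sqr_ge0.
  apply: (disagreement_sqr_le (E := E)) => // j i; exact: (reach_all t j i Eii sc).
(* Bounds the initial energy for every comparison point of norm at most [rw]; the factor [n + m]
   passes from the sup norm to the Euclidean norm. *)
pose W := \sum_(i < m) (n + m)%:R * (`|theta i 0%N| + rw) ^+ 2.
have energy T : exists G : nat -> R,
    eta * \sum_(s < T) q s + 2 * \sum_(t < T) alpha t * G t <= W /\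
    forall t, (t < T)%N -> - (C * dd t.+1) <= G t /\
      forall i, F i t.+1 - dd t.+1 <= G t.
  have [p [pl p1 pS]] := absolute_probability_lb (ltW gam0) AE A0 T m0 (ltW gam1) Eii sc A1.
  have p0 t i : (t <= T)%N -> 0 <= p t i.
    by move=> tT; rewrite (le_trans (ltW eta0))// pl.
  exists (fun t => \sum_i p t.+1 i * F i t.+1); split; last first.
    move=> t tT; split=> [|i].
      rewrite -[leLHS]mul1r -(p1 t.+1)// mulr_suml.
      by apply: ler_sum => i _; rewrite ler_wpM2l ?p0.
    rewrite -[leLHS]mul1r -(p1 t.+1)// mulr_suml.
    apply: ler_sum => j _; rewrite ler_wpM2l ?p0// /F.
    have := f0_lipschitz m0 (theta i t.+1) (theta j t.+1).
    have := dist_le_disagreement theta t.+1 i j; rewrite /dd; lra.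
  (* The comparison point is only optimal up to [del], at a total cost of at most [e]; as [W] does
     not depend on that point, [e] is arbitrary. The 1 in the denominator of [del] guards the empty
     sum. *)
  apply/ler_addgt0Pr => e e0.
  have sal : 0 <= \sum_(t < T) alpha t by apply: sumr_ge0 => t _; exact: ltW.
  pose del := e / (2 * \sum_(t < T) alpha t + 1).
  have del0 : 0 < del by rewrite divr_gt0// ltr_wpDl// mulr_ge0.
  have dele : 2 * del * \sum_(t < T) alpha t <= e.
    have : del * (2 * \sum_(t < T) alpha t + 1) = e.
      by rewrite divfK// gt_eqF// ltr_wpDl// mulr_ge0.
    by lra.
  have [w [Ow fw wr]] := near_min del del0.
  have := energy_decrease A0 A1 (fun i => Omega_i_convex cX cf cg (i := i)) Ow proj (ltW eta0) pl pS.
  have VW : \sum_i p 0%N i * sqnorm (theta i 0%N - w) <= W.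
    apply: ler_sum => i _; apply: (@le_trans _ _ (sqnorm (theta i 0%N - w))).
      rewrite ler_piMl ?sqnorm_ge0// -(p1 0%N)// (bigD1 i)//= lerDl.
      by apply: sumr_ge0 => j _; exact: p0.
    rewrite (le_trans (sqnorm_le_norm _))// ler_wpM2l//.
    rewrite ler_sqr ?nnegrE ?addr_ge0 ?(le_trans _ wr)//.
    by rewrite (le_trans (ler_normB _ _))// lerD2l.
  have : \sum_(t < T) alpha t * \sum_i p t.+1 i * F i t.+1 <=
      \sum_(t < T) alpha t * \sum_i p t.+1 i * dotv (cvec R n m) (theta i t.+1 - w)
      + del * \sum_(t < T) alpha t.
    rewrite mulr_sumr -big_split/=; apply: ler_sum => t _.
    rewrite [del * _]mulrC -mulrDr ler_wpM2l ?(ltW (al0 _))//.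
    rewrite -[del]mul1r -(p1 t.+1)// mulr_suml -big_split/=.
    apply: ler_sum => i _; rewrite -mulrDr ler_wpM2l ?p0// /F dotvC dotvDl dotvNl.
    by rewrite !(dotvC _ (cvec R n m)) -/(f0 _) -/(f0 _); lra.
  by rewrite -/q; lra.
have F0 i : `|F i 0%N| <= \sum_j `|F j 0%N|.
  by rewrite (bigD1 i)//= lerDl sumr_ge0.
have alk2 t : alpha t <= k2 / Num.sqrt t.+1%:R by have /andP[] := alk t.
have C2 : 0 <= C1 * B%:R by rewrite mulr_ge0.
have [K HK] := weighted_gap_bound C2 eta0 C0 al0 alS alk2 q0 d0 F0 dq energy FC.
(* The total weight [Sal] is at least [k1 * sqrt t], whence the division by [k1]. *)
exists (K / k1) => i t t1.
pose Sal := \sum_(r < t.+1) alpha r.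
have st0 : 0 < Num.sqrt t%:R :> R by rewrite sqrtr_gt0 ltr0n.
have Salk : k1 * Num.sqrt t%:R <= Sal.
  apply: (@le_trans _ _ (k1 * \sum_(r < t.+1) (Num.sqrt r.+1%:R)^-1)).
    by rewrite ler_wpM2l ?sqrt_sum_ge// ltW.
  by rewrite mulr_sumr; apply: ler_sum => r _; have /andP[] := alk r.
have Sal0 : 0 < Sal by rewrite (lt_le_trans _ Salk)// mulr_gt0.
(* [f0] is linear, so the gap of the weighted average is the weighted average of the gaps. *)
have -> : f0 (theta_hat alpha (theta i) t) - fstar =
    Sal^-1 * \sum_(r < t.+1) alpha r * F i r.
  rewrite /f0 /theta_hat dotvC dotvZl dotv_suml -/Sal.
  under [in RHS]eq_bigr do rewrite mulrBr.
  rewrite sumrB -mulr_suml -/Sal mulrBr mulKf ?gt_eqF//; congr (_ * _ - _).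
  by apply: eq_bigr => r _; rewrite dotvZl dotvC.
rewrite normrM gtr0_norm ?invr_gt0// mulrC ler_pdivrMr//.
apply: le_trans (HK i t t1) _.
have Kln : 0 <= K * ln t.+1%:R := le_trans (normr_ge0 _) (HK i t t1).
have kt0 : 0 < k1 * Num.sqrt t%:R by rewrite mulr_gt0.
have -> : K / k1 * ln t.+1%:R / Num.sqrt t%:R = K * ln t.+1%:R / (k1 * Num.sqrt t%:R).
  by rewrite invfM [K / k1 * _]mulrAC !mulrA.
by rewrite mulrAC ler_pdivlMr// ler_wpM2l.
Qed.
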